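(* Let $R$ be a commutative ring. Let $(A,B,C,\lambda)$ and $(\tilde A,\tilde B,\tilde C,\tilde\lambda)$ be tuples with $A,B,\tilde A,\tilde B$ finite $R$-modules, $C,\tilde C$ finite cyclic groups, and $\lambda:A\times B\to C$, $\tilde\lambda:\tilde A\times\tilde B\to\tilde C$ $\mathbb{Z}$-bilinear, $R$-balanced and non-degenerate. Let $t_A:A\to\tilde A$ be an $R$-module isomorphism and $t_C:C\to\tilde C$ a group isomorphism. Then (1) there exists a unique group homomorphism $t_B:B\to\tilde B$ such that the map $\underline t=t_A\times t_B\times t_C:\mathcal{H}(A,B,C,\lambda)\to\mathcal{H}(\tilde A,\tilde B,\tilde C,\tilde\lambda)$, $h(a,b,c)\mapsto h(t_A(a),t_B(b),t_C(c))$, is a group homomorphism; and (2) this $t_B$ is an $R$-module isomorphism and $\underline t$ is an $R$-linear group isomorphism.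
   Context: $\mathcal{H}(A,B,C,\lambda)$ is the set $A\times B\times C$ with elements $h(a,b,c)$ and multiplication $h(a,b,c)h(a',b',c')=h(a+a',b+b',c+c'+\lambda(a,b'))$. $R$-balanced: $\lambda(ra,b)=\lambda(a,rb)$ for $r\in R$. Non-degenerate: left and right kernels of $\lambda$ are zero. A homomorphism $\theta$ between such groups mapping $h(0,0,C)$ into $h(0,0,\tilde C)$ is called $R$-linear if the induced map $A\oplus B\to\tilde A\oplus\tilde B$ is $R$-linear. *)

(* Defs.v *)
From HB Require Import structures.
From mathcomp Require Import all_boot all_order all_algebra all_fingroup.
From mathcomp Require Import all_solvable.

Set Implicit Arguments.
Unset Strict Implicit.
Unset Printing Implicit Defensive.

Import GRing.Theory.

Local Open Scope ring_scope.

(* Used for modules, since [finLmodType] requires a nontrivial ring of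
   scalars. *)
Definition is_finite (T : eqType) := exists e : seq T, Finite.axiom e.

(* [M^z] is the abelian group [M] seen as a module over [int], so that
   [{bilinear A^z -> B^z -> C^z}] is the type of Z-bilinear maps. *)
Notation "M ^z" := (zmodule M) (format "M ^z") : type_scope.

(* The form [lam] is a phantom parameter: it determines the group law. *)
Record heis (A B C : zmodType) (lam : {bilinear A^z -> B^z -> C^z}) :=
  Heis { heisA : A; heisB : B; heisC : C }.

Arguments Heis {A B C} lam _ _ _.

Section Heisenberg.

Variables (A B C : zmodType) (lam : {bilinear A^z -> B^z -> C^z}).

Lemma lam0l (b : B) : lam (0 : A) b = 0 :> C.
Proof. exact: (linear0l lam b). Qed.

Lemma lam0r (a : A) : lam a (0 : B) = 0 :> C.
Proof. exact: (linear0r lam a). Qed.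

Lemma lamDl (a a' : A) (b : B) : lam (a + a') b = (lam a b : C) + lam a' b.
Proof. exact: (linearDl lam b a a'). Qed.

Lemma lamDr (a : A) (b b' : B) : lam a (b + b') = (lam a b : C) + lam a b'.
Proof. exact: (linearDr lam a b b'). Qed.

Lemma lamNl (a : A) (b : B) : lam (- a) b = - (lam a b : C).
Proof. exact: (linearNl lam b a). Qed.

Lemma lamNr (a : A) (b : B) : lam a (- b) = - (lam a b : C).
Proof. exact: (linearNr lam a b). Qed.

Definition nondegenerate_pairing :=
  (forall a : A, (forall b : B, lam a b = 0 :> C) -> a = 0) /\
  (forall b : B, (forall a : A, lam a b = 0 :> C) -> b = 0).

Definition heis_tuple (x : heis lam) := (heisA x, heisB x, heisC x).
Definition tuple_heis (u : A * B * C) := Heis lam u.1.1 u.1.2 u.2.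

Lemma heis_tupleK : cancel heis_tuple tuple_heis.
Proof. by case. Qed.

HB.instance Definition _ := Choice.copy (heis lam) (can_type heis_tupleK).

Definition heis_mul (x y : heis lam) : heis lam :=
  Heis lam (heisA x + heisA y) (heisB x + heisB y)
       (heisC x + heisC y + lam (heisA x) (heisB y)).

Definition heis_one : heis lam := Heis lam 0 0 0.

Definition heis_inv (x : heis lam) : heis lam :=
  Heis lam (- heisA x) (- heisB x) (- heisC x + lam (heisA x) (heisB x)).

Lemma heis_mulA : associative heis_mul.
Proof.
move=> [a b c] [a' b' c'] [a'' b'' c'']; rewrite /heis_mul /= lamDl lamDr.
f_equal; rewrite ?addrA //.
rewrite -!addrA; congr (_ + (_ + _)).
by rewrite [RHS]addrCA; congr (_ + _); rewrite addrC -addrA.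
Qed.

Lemma heis_mul1g : left_id heis_one heis_mul.
Proof. by case=> a b c; rewrite /heis_mul /= lam0l !add0r addr0. Qed.

Lemma heis_mulg1 : right_id heis_one heis_mul.
Proof. by case=> a b c; rewrite /heis_mul /= lam0r !addr0. Qed.

Lemma heis_mulVg : left_inverse heis_one heis_inv heis_mul.
Proof.
case=> a b c.
by rewrite /heis_mul /= lamNl !addNr addrAC addrK addNr.
Qed.

Lemma heis_mulgV : right_inverse heis_one heis_inv heis_mul.
Proof.
case=> a b c.
by rewrite /heis_mul /= lamNr !subrr addrA subrr add0r subrr.
Qed.

HB.instance Definition _ := isGroup.Build (heis lam)
  heis_mulA heis_mul1g heis_mulg1 heis_mulVg heis_mulgV.

End Heisenberg.

Definition balanced_pairing (R : comPzRingType) (A B : lmodType R) (C : zmodType)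
    (lam : {bilinear A^z -> B^z -> C^z}) :=
  forall (r : R) (a : A) (b : B), lam (r *: a) b = lam a (r *: b) :> C.

Section RLinear.

Variables (R : comPzRingType) (A B A' B' : lmodType R) (C C' : zmodType).
Variables (lam : {bilinear A^z -> B^z -> C^z}).
Variables (lam' : {bilinear A'^z -> B'^z -> C'^z}).
Implicit Type theta : heis lam -> heis lam'.

Definition heisAB (D E F : zmodType) (mu : {bilinear D^z -> E^z -> F^z})
  (x : heis mu) : D * E := (heisA x, heisB x).

Definition preserves_heisC theta :=
  forall c : C, exists c' : C', theta (Heis lam 0 0 c) = Heis lam' 0 0 c'.

(* The map induced on A (+) B = H / h(0,0,C), computed on representatives;
   [heis_inducedE] shows that it does not depend on their choice. *)
Definition heis_induced theta (u : A * B) : A' * B' :=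
  heisAB (theta (Heis lam u.1 u.2 0)).

Lemma heis_inducedE theta :
    {morph theta : x y / (x * y)%g} -> preserves_heisC theta ->
  forall x, heisAB (theta x) = heis_induced theta (heisAB x).
Proof.
move=> thetaM thetaC [a b c]; rewrite /heis_induced /=.
have ->: Heis lam a b c = (Heis lam a b 0 * Heis lam 0 0 c)%g.
  by rewrite /mul /= /heis_mul /= lam0r !addr0 add0r.
rewrite thetaM; have [c' ->] := thetaC c.
by rewrite /heisAB /= !addr0.
Qed.

Definition heis_Rlinear theta :=
  [/\ {morph theta : x y / (x * y)%g}, preserves_heisC theta
    & linear (heis_induced theta)].

End RLinear.

Definition heis_map (A B C A' B' C' : zmodType)
    (lam : {bilinear A^z -> B^z -> C^z})
    (lam' : {bilinear A'^z -> B'^z -> C'^z})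
    (tA : A -> A') (tB : B -> B') (tC : C -> C') (x : heis lam) : heis lam' :=
  Heis lam' (tA (heisA x)) (tB (heisB x)) (tC (heisC x)).

Arguments heis_map {A B C A' B' C'} lam lam' tA tB tC x.

(* Main.v *)
(** Over a finite cyclic [C], which embeds in the multiplicative group of the
    algebraic numbers, a nondegenerate pairing [A x B -> C] represents every
    additive [chi : A -> C] as [lam ^~ b]: if [psi : C -> algC] is an injective
    character, then
      [\sum_b \sum_a psi (chi a - lam a b) = #|B| != 0],
    because only [a = 0] contributes, so some inner sum is nonzero and the
    character [a |-> psi (chi a - lam a b)] is trivial. Now [heis_map] is
    multiplicative iff [lam' (tA a) (tB b) = tC (lam a b)], which defines [tB]
    as an adjoint; uniqueness, linearity and bijectivity follow from
    nondegeneracy. *)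
Require Import Defs.
From HB Require Import structures.
From mathcomp Require Import all_boot all_order all_algebra all_fingroup.
From mathcomp Require Import all_solvable all_field.
From Stdlib Require Import FunctionalExtensionality.

Set Implicit Arguments.
Unset Strict Implicit.
Unset Printing Implicit Defensive.

Import GRing.Theory.

Local Open Scope ring_scope.

(** A generator [g] is sent to a primitive root of unity [z] of the same order. The exponents [l x]
    are arbitrary discrete logarithms: powers of [z] agree exactly when those of [g] do. *)
Lemma cyclic_embed_algC (C : finZmodType) : cyclic [set: C] ->
  exists psi : C -> algC,
    [/\ injective psi, psi 0 = 1 & {morph psi : x y / x + y >-> x * y}].
Proof.
case/cyclicP=> g defC.
have [z z_prim] := C_prim_root_exists (order_gt0 g).
have /fin_all_exists[l gl] (x : C) : exists k, x = (g ^+ k)%g.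
  have : x \in <[g]>%g by rewrite -defC inE.
  by case/cycleP=> k ->; exists k.
have zE i j : (z ^+ i == z ^+ j) = (g ^+ i == g ^+ j)%g.
  by rewrite (eq_prim_root_expr z_prim) eq_expg_mod_order.
exists (fun x => z ^+ l x); split=> [x y /eqP||x y].
- by rewrite zE -!gl => /eqP.
- by apply/eqP; rewrite -(expr0 z) zE -gl expg0.
- by apply/eqP; rewrite -exprD zE expgD -!gl.
Qed.

Lemma mem_finite_axiom (T : eqType) (e : seq T) (x : T) :
  Finite.axiom e -> x \in e.
Proof. by move=> eP; rewrite -has_pred1 has_count eP. Qed.

Lemma uniq_finite_axiom (T : eqType) (e : seq T) : Finite.axiom e -> uniq e.
Proof.
by move=> eP; apply: count_mem_uniq => x; rewrite eP mem_finite_axiom.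
Qed.

(** Translation by [g] permutes [e], so the sum equals [f g] times itself, and [f g - 1] can be
    cancelled in a domain. *)
Lemma sum_character_eq0 (G : zmodType) (F : idomainType) (e : seq G)
    (f : G -> F) (g : G) :
  Finite.axiom e -> {morph f : x y / x + y >-> x * y} -> f g != 1 ->
  \sum_(x <- e) f x = 0.
Proof.
move=> eP fM fg_neq1.
have e_uniq := uniq_finite_axiom eP.
have e_shift : perm_eq e [seq g + x | x <- e].
  apply: uniq_perm => // [|x]; first by rewrite map_inj_uniq //; apply: addrI.
  by rewrite mem_finite_axiom //; apply/esym/mapP; exists (- g + x);
    rewrite ?addNKr ?mem_finite_axiom.
apply/eqP; have /eqP : \sum_(x <- e) f x = f g * \sum_(x <- e) f x.
  rewrite {1}(perm_big _ e_shift) big_map mulr_sumr.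
  by apply: eq_bigr => x _; rewrite fM.
rewrite -subr_eq0 -{1}[\sum_(x <- e) _]mul1r -mulrBl mulf_eq0 subr_eq0 eq_sym.
by rewrite (negPf fg_neq1).
Qed.

Lemma pairing_represents (A B : zmodType) (C : finZmodType)
    (lam : {bilinear A^z -> B^z -> C^z}) (chi : A -> C) :
  is_finite A -> is_finite B -> cyclic [set: C] -> nondegenerate_pairing lam ->
  {morph chi : x y / x + y} -> exists b : B, forall a : A, lam a b = chi a :> C.
Proof.
move=> [eA eAP] [eB eBP] /cyclic_embed_algC[psi [psi_inj psi0 psiD]] [lamA _].
move=> chiD; have chi0 : chi 0 = 0 by apply: (addrI (chi 0)); rewrite -chiD !addr0.
pose f b a := psi (chi a - (lam a b : C)).
have [/hasP[b _ sum_neq0]|/hasPn sum_eq0] :=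
    boolP (has (fun b => \sum_(a <- eA) f b a != 0) eB).
  exists b => a; apply/esym/eqP; rewrite -subr_eq0 -(inj_eq psi_inj) psi0.
  apply: contraNT sum_neq0 => fa_neq1; apply/eqP.
  apply: (sum_character_eq0 eAP (g := a)) fa_neq1 => x y.
  by rewrite /f -psiD chiD lamDl opprD addrACA.
(* For fixed [a], the sum is [psi (chi a)] times the sum of the character [psi (- lam a b)] of [B],
   nontrivial because the left kernel is zero. *)
have inner0 a : a != 0 -> \sum_(b <- eB) f b a = 0.
  move=> a_neq0; have [b lam_ab] : exists b : B, (lam a b : C) != 0.
    have [/hasP[b _ ?]|/hasPn lam_a0] :=
      boolP (has (fun b : B => (lam a b : C) != 0) eB); first by exists b.
    case/eqP: a_neq0; apply: lamA => b; apply/eqP; rewrite -[_ == _]negbK.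
    exact/lam_a0/mem_finite_axiom.
  rewrite /f; under eq_bigr => c _ do rewrite psiD.
  rewrite -mulr_sumr (sum_character_eq0 eBP (g := b)) ?mulr0 // => [x y|].
    by rewrite -psiD lamDr opprD.
  by rewrite -psi0 (inj_eq psi_inj) oppr_eq0.
(* If every inner sum vanished, exchanging the sums would leave only the terms at [a = 0], giving
   [size eB = 0] in characteristic zero, although [eB] contains 0. *)
have : \sum_(b <- eB) \sum_(a <- eA) f b a = 0.
  by rewrite big_seq big1 // => b /sum_eq0; rewrite negbK => /eqP.
rewrite exchange_big (bigD1_seq 0) ?mem_finite_axiom ?uniq_finite_axiom //=.
rewrite [X in _ + X](big1 _ _ _ inner0) addr0 /f.
under eq_bigr => b _ do rewrite chi0 lam0l subr0 psi0.
rewrite big_const_seq count_predT iter_addr_0 => /eqP.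
rewrite Num.Theory.pnatr_eq0 => /eqP/size0nil eB0.
by have := eBP 0; rewrite eB0.
Qed.

(** Each [b] gives the additive map [tC (lam (sA a) b)] on [A'], which [lam'] represents. This
    serves twice: for [tB], and with the two sides exchanged for its inverse. *)
Lemma pairing_adjoint (A B A' B' : zmodType) (C C' : finZmodType)
    (lam : {bilinear A^z -> B^z -> C^z})
    (lam' : {bilinear A'^z -> B'^z -> C'^z})
    (sA : A' -> A) (tC : C -> C') :
  is_finite A' -> is_finite B' -> cyclic [set: C'] ->
  nondegenerate_pairing lam' ->
  {morph sA : x y / x + y} -> {morph tC : x y / x + y} ->
  exists tB : B -> B', forall a b, lam' a (tB b) = tC (lam (sA a) b) :> C'.
Proof.
move=> A'_fin B'_fin C'_cyclic lam'_nondeg sAD tCD.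
have [e eP] := A'_fin.
(* Testing over the finite enumeration makes the condition boolean, so that [xchoose] can select a
   witness for each [b]. *)
have repr b : exists b' : B',
    all (fun a => (lam' a b' : C') == tC (lam (sA a) b)) e.
  have chiD : {morph (fun a => tC (lam (sA a) b)) : x y / x + y}.
    by move=> x y; rewrite sAD lamDl tCD.
  have [b' b'P] :=
    pairing_represents A'_fin B'_fin C'_cyclic lam'_nondeg chiD.
  by exists b'; apply/allP => a _; rewrite b'P.
exists (fun b => xchoose (repr b)) => a b; apply/eqP.
exact: (allP (xchooseP (repr b)) _ (mem_finite_axiom a eP)).
Qed.

Lemma nondegenerate_injr (A B C : zmodType)
    (lam : {bilinear A^z -> B^z -> C^z}) (b b' : B) :
  nondegenerate_pairing lam -> (forall a : A, lam a b = lam a b' :> C) ->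
  b = b'.
Proof.
move=> [_ lamB] eq_b; apply/eqP; rewrite -subr_eq0; apply/eqP/lamB => a.
by rewrite lamDr lamNr eq_b subrr.
Qed.

Lemma heis_map_morphP (A B A' B' C C' : zmodType)
    (lam : {bilinear A^z -> B^z -> C^z})
    (lam' : {bilinear A'^z -> B'^z -> C'^z})
    (tA : {additive A -> A'}) (tB : B -> B') (tC : {additive C -> C'}) :
  zmod_morphism tB ->
  {morph heis_map lam lam' tA tB tC : x y / (x * y)%g} <->
  (forall a b, lam' (tA a) (tB b) = tC (lam a b) :> C').
Proof.
move=> tB_zmod.
pose tBm := GRing.isZmodMorphism.Build B B' tB tB_zmod.
pose tBa : {additive B -> B'} := HB.pack tB tBm.
have tBD : {morph tB : x y / x + y} := raddfD tBa.
split=> [tM a b|tE [a b c] [a' b' c']].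
  (* The last coordinate of h(a,0,0) h(0,b,0) is exactly [lam a b]. *)
  have /(congr1 (@heisC _ _ _ _)) := tM (Heis lam a 0 0) (Heis lam 0 b 0).
  by rewrite /= !raddf0 !add0r.
rewrite /mul /= /heis_mul /heis_map /=.
by rewrite tBD !raddfD tE.
Qed.

Theorem theorem5p8 (R : comPzRingType) (A B A' B' : lmodType R)
    (C C' : finZmodType)
    (lam : {bilinear A^z -> B^z -> C^z})
    (lam' : {bilinear A'^z -> B'^z -> C'^z})
    (A_fin : is_finite A) (B_fin : is_finite B)
    (A'_fin : is_finite A') (B'_fin : is_finite B')
    (C_cyclic : cyclic [set: C]) (C'_cyclic : cyclic [set: C'])
    (lam_balanced : balanced_pairing lam) (lam'_balanced : balanced_pairing lam')
    (lam_nondeg : nondegenerate_pairing lam) (lam'_nondeg : nondegenerate_pairing lam')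
    (tA : {linear A -> A'}) (tA_bij : bijective tA)
    (tC : {additive C -> C'}) (tC_bij : bijective tC) :
  let t (tB : B -> B') := heis_map lam lam' tA tB tC in
  let good (tB : B -> B') :=
    zmod_morphism tB /\ {morph t tB : x y / (x * y)%g} in
  (exists! tB : B -> B', good tB) /\
  (forall tB : B -> B', good tB ->
     (linear tB /\ bijective tB) /\
     (heis_Rlinear (t tB) /\ bijective (t tB))).
Proof.
move=> t good; have [sA tAK sAK] := tA_bij; have [sC tCK sCK] := tC_bij.
have sAD : {morph sA : x y / x + y}.
  by move=> x y; apply: (can_inj tAK); rewrite linearD !sAK.
have sCD : {morph sC : x y / x + y}.
  by move=> x y; apply: (can_inj tCK); rewrite raddfD !sCK.
have goodE tB : good tB -> forall a b, lam' (tA a) (tB b) = tC (lam a b) :> C'.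
  by case=> tB_zmod /(heis_map_morphP lam lam' tA tC tB_zmod).
(* As [tA] is surjective, testing against its values suffices. *)
have injr b b' : (forall a, lam' (tA a) b = lam' (tA a) b' :> C') -> b = b'.
  move=> eq_b; apply: (nondegenerate_injr lam'_nondeg) => a.
  by rewrite -[a]sAK eq_b.
split=> [|tB tB_good].
  have [tB tBE] := pairing_adjoint lam A'_fin B'_fin C'_cyclic lam'_nondeg
    sAD (raddfD tC).
  have tBE' a b : lam' (tA a) (tB b) = tC (lam a b) :> C' by rewrite tBE tAK.
  have tB_zmod : zmod_morphism tB.
    move=> x y; apply: injr => a.
    by rewrite lamDr lamNr !tBE' lamDr lamNr raddfB.
  exists tB; split=> [|tB' tB'_good].
    by split=> //; apply/(heis_map_morphP lam lam' tA tC tB_zmod).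
  apply: functional_extensionality => b; apply: injr => a.
  by rewrite tBE' (goodE tB').
have tBE := goodE tB tB_good; have [_ tM] := tB_good.
have tAD : {morph tA : x y / x + y} := raddfD tA.
have [sB sBE] := pairing_adjoint lam' A_fin B_fin C_cyclic lam_nondeg
  tAD sCD.
have tBK : cancel tB sB.
  move=> b; apply: (nondegenerate_injr lam_nondeg) => a.
  by rewrite sBE tBE tCK.
have sBK : cancel sB tB by move=> b; apply: injr => a; rewrite tBE sBE sCK.
have tB_lin : linear tB.
  move=> r x y; apply: injr => a.
  (* The scalar [r] moves to the left argument of [lam'], passes through [tA], and returns to the
     right argument of [lam]. *)
  rewrite tBE !lamDr -lam'_balanced -linearZ !tBE raddfD /=.
  by rewrite -lam_balanced.
split; split=> //; first by exists sB.
  split=> // [c|r u v].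
    (* [tB 0 = 0] is linearity at scalar -1 and zero vectors. *)
    by exists (tC c); rewrite /t /heis_map /= raddf0 (_ : tB 0 = 0) //;
       have := tB_lin (-1) 0 0; rewrite scaler0 addr0 scaleN1r addNr.
  by rewrite /heis_induced /heisAB /= linearP tB_lin.
exists (heis_map lam' lam sA sB sC) => [[a b c]|[a b c]]; rewrite /t /heis_map /=.
  by rewrite tAK tBK tCK.
by rewrite sAK sBK sCK.
Qed.
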